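(* There is no positive integer $n$ with $p^2(n,6)=36$; that is, no positive integer can be expressed as the sum of exactly $6$ positive squares in exactly $36$ ways.
   Context: $p^2(n,j)$ denotes the number of ways to write $n$ as a sum of exactly $j$ positive squares, up to order of summands. *)

(* Defs.v *)
From mathcomp Require Import all_boot.

Set Implicit Arguments.
Unset Strict Implicit.
Unset Printing Implicit Defensive.

Definition is_pos_square (m : nat) : bool :=
  [exists k : 'I_m.+1, (0 < k) && (m == k ^ 2)].

(* The ways to write n as a sum of exactly j positive squares, up to order:
   each unordered way is represented by its nondecreasing tuple of summands.
   A summand of n is at most n, hence the index type 'I_n.+1. *)
Definition square_partitions (n j : nat) : {set j.-tuple 'I_n.+1} :=
  [set t : j.-tuple 'I_n.+1 |
    [&& sorted leq (map val t),
        all is_pos_square (map val t)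
      & \sum_(i < j) tnth t i == n]].

Definition p2 (n j : nat) : nat := #|square_partitions n j|.

(* Main.v *)
Require Import Defs.
From mathcomp Require Import all_boot.
From mathcomp Require Import all_order all_algebra.
From mathcomp Require Import zify ring lra.
Import Order.TTheory GRing.Theory Num.Theory.

(** Adding a fixed square k^2 to a partition is injective, so
    p^2(n,6) >= p^2(n - k^2,5). Since p^2(r,5) >= 37 for 700 <= r <= 1130 and
    consecutive squares are close, choosing k with n - k^2 in this window settles
    701 <= n < 47258, while n <= 700 is a computation. For larger n, every
    k <= 217 satisfies n - k^2 >= 169, and every integer >= 169 is a sum of five
    positive squares: subtract 169, apply Lagrange's theorem, and complete the
    nonzero squares by writing 169 as a sum of 1, 2, 3, 4 or 5 of them. So each
    of 217 distinct squares occurs in some partition of n; a partition has at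
    most 6 distinct parts, hence 6 p^2(n,6) >= 217 > 6 * 36. *)

(** * Lagrange's four-square theorem *)

(** The roots are integers because Euler's identity and centered residues produce negative ones. *)
Definition sum4sq (n : nat) : Prop :=
  exists a b c d : int, (n%:Z = a ^+ 2 + b ^+ 2 + c ^+ 2 + d ^+ 2)%R.

(** Euler's four-square identity, that is, multiplicativity of the quaternion norm. *)
Lemma sum4sq_mul (m n : nat) : sum4sq m -> sum4sq n -> sum4sq (m * n).
Proof.
move=> [a [b [c [d Em]]]] [x [y [z [t En]]]].
exists (a * x + b * y + c * z + d * t)%R, (a * y - b * x + c * t - d * z)%R,
  (a * z - c * x + d * y - b * t)%R, (a * t - d * x + b * z - c * y)%R.
rewrite PoszM Em En; ring.
Qed.

Lemma centered_residue (m : nat) (x : int) : 0 < m ->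
  exists y q : int, (x = y + m%:Z * q)%R /\ (4 * y ^+ 2 <= m%:Z ^+ 2)%R.
Proof.
move=> m_gt0.
have E := divz_eq x m; have r_ge0 := modz_ge0 x (_ : (m%:Z != 0)%R).
have r_lt := ltz_pmod x (_ : (0 < m%:Z)%R).
have {r_ge0}r_ge0 : (0 <= (x %% m)%Z)%R by apply: r_ge0; lia.
have {r_lt}r_lt : ((x %% m)%Z < m%:Z)%R by apply: r_lt; lia.
move: E r_ge0 r_lt; set q := (x %/ m)%Z; set r := (x %% m)%Z => E r0 rm.
have [le_rm|lt_mr] := lerP (2 * r)%R m%:Z.
  by exists r, q; split; [rewrite E; ring | nia].
by exists (r - m%:Z)%R, (q + 1)%R; split; [rewrite E; ring | nia].
Qed.

(** Lagrange's descent: the centered residues of the four roots mod [m] have squares summing to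
    [m * r] with [r <= m]. Both extremes [r = 0] and [r = m] would make [m] divide the prime [p]. *)
Lemma sum4sq_descent (p m : nat) : prime p -> 1 < m < p -> sum4sq (m * p) ->
  exists2 r, 0 < r < m & sum4sq (r * p).
Proof.
move=> p_pr /andP[m_gt1 m_ltp] [x1 [x2 [x3 [x4 Emp]]]].
have m_gt0 : 0 < m by lia.
have [y1 [q1 [E1 le1]]] := centered_residue m x1 m_gt0.
have [y2 [q2 [E2 le2]]] := centered_residue m x2 m_gt0.
have [y3 [q3 [E3 le3]]] := centered_residue m x3 m_gt0.
have [y4 [q4 [E4 le4]]] := centered_residue m x4 m_gt0.
have m_neq0 : (m%:Z != 0)%R by lia.
have m_ndiv (k : int) : (p%:Z = m%:Z * k)%R -> False.
  move=> Epk; have : (m %| p)%N.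
    by apply/dvdnP; exists `|k|%N; rewrite mulnC -[p]/`|Posz p|%N Epk abszM.
  case/primeP: p_pr => _ pP /pP /orP[] /eqP Em.
    by rewrite Em in m_gt1.
  by rewrite Em ltnn in m_ltp.
(* The quotient of the sum of the [y_i ^ 2] by [m], written without division by expanding
   [x_i = y_i + m q_i]. *)
pose r := (p%:Z - (2 * (y1 * q1 + y2 * q2 + y3 * q3 + y4 * q4)
            + m%:Z * (q1 ^+ 2 + q2 ^+ 2 + q3 ^+ 2 + q4 ^+ 2)))%R.
have Er : (m%:Z * r = y1 ^+ 2 + y2 ^+ 2 + y3 ^+ 2 + y4 ^+ 2)%R.
  by rewrite /r mulrBr -PoszM Emp E1 E2 E3 E4; ring.
have Ep : (p%:Z = r + (2 * (y1 * q1 + y2 * q2 + y3 * q3 + y4 * q4)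
            + m%:Z * (q1 ^+ 2 + q2 ^+ 2 + q3 ^+ 2 + q4 ^+ 2)))%R.
  by rewrite /r; ring.
have r_ge0 : (0 <= r)%R.
  rewrite -(pmulr_rge0 r (_ : 0 < m%:Z)%R) ?ltz_nat // Er.
  by rewrite !addr_ge0 ?sqr_ge0.
have r_lem : (r <= m%:Z)%R.
  rewrite -(ler_pM2l (_ : 0 < m%:Z)%R) ?ltz_nat // Er.
  by lra.
have r_neq0 : (r != 0)%R.
  apply/eqP => r0; move: Er; rewrite r0 mulr0 => /esym Ey.
  have z1 := sqr_ge0 y1; have z2 := sqr_ge0 y2.
  have z3 := sqr_ge0 y3; have z4 := sqr_ge0 y4.
  have /eqP y10 : (y1 == 0)%R by rewrite -sqrf_eq0; apply/eqP; lra.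
  have /eqP y20 : (y2 == 0)%R by rewrite -sqrf_eq0; apply/eqP; lra.
  have /eqP y30 : (y3 == 0)%R by rewrite -sqrf_eq0; apply/eqP; lra.
  have /eqP y40 : (y4 == 0)%R by rewrite -sqrf_eq0; apply/eqP; lra.
  apply: (m_ndiv (q1 ^+ 2 + q2 ^+ 2 + q3 ^+ 2 + q4 ^+ 2)%R).
  by rewrite Ep r0 y10 y20 y30 y40; ring.
(* Equality forces every bound [4 y_i ^ 2 <= m ^ 2] to be tight, so each [2 y_i] is a multiple of
   [m], and hence so is [p]. *)
have r_neqm : (r != m%:Z)%R.
  apply/eqP => rm; move: Er; rewrite rm => /esym Ey.
  have half (y : int) : (4 * y ^+ 2 = m%:Z ^+ 2)%R ->
      exists e : int, (2 * y = m%:Z * e)%R.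
    move=> Hy; have : ((2 * y) ^+ 2 == m%:Z ^+ 2)%R by rewrite -Hy; apply/eqP; ring.
    rewrite eqf_sqr => /orP[] /eqP ->.
      by exists 1%R; rewrite mulr1.
    by exists (-1)%R; rewrite mulrN1.
  have [e1 F1] : exists e : int, (2 * y1 = m%:Z * e)%R by apply: half; lra.
  have [e2 F2] : exists e : int, (2 * y2 = m%:Z * e)%R by apply: half; lra.
  have [e3 F3] : exists e : int, (2 * y3 = m%:Z * e)%R by apply: half; lra.
  have [e4 F4] : exists e : int, (2 * y4 = m%:Z * e)%R by apply: half; lra.
  apply: (m_ndiv (1 + (e1 * q1 + e2 * q2 + e3 * q3 + e4 * q4) +
     (q1 ^+ 2 + q2 ^+ 2 + q3 ^+ 2 + q4 ^+ 2))%R).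
  by rewrite Ep rm !mulrDr !mulrA F1 F2 F3 F4; ring.
have Enat := gez0_abs r_ge0.
exists `|r|%N.
  by rewrite -!ltz_nat Enat !lt_neqAle eq_sym r_neq0 r_ge0 r_neqm r_lem.
exists (r + q1 * y1 + q2 * y2 + q3 * y3 + q4 * y4)%R,
  (q1 * y2 - q2 * y1 + q3 * y4 - q4 * y3)%R,
  (q1 * y3 - q3 * y1 + q4 * y2 - q2 * y4)%R,
  (q1 * y4 - q4 * y1 + q2 * y3 - q3 * y2)%R.
(* Multiply by m^2: this is Euler's identity for (m p) (m r), where
   x_i = y_i + m q_i makes each of the four squared terms divisible by m. *)
have m2_neq0 : (m%:Z * m%:Z != 0)%R by rewrite mulf_neq0.
apply: (mulfI m2_neq0).
transitivity ((m * p)%:Z * (m%:Z * r))%R; first by rewrite !PoszM Enat; ring.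
transitivity ((m%:Z * r + m%:Z * (q1 * y1 + q2 * y2 + q3 * y3 + q4 * y4)) ^+ 2
  + m%:Z * m%:Z * ((q1 * y2 - q2 * y1 + q3 * y4 - q4 * y3) ^+ 2
  + (q1 * y3 - q3 * y1 + q4 * y2 - q2 * y4) ^+ 2
  + (q1 * y4 - q4 * y1 + q2 * y3 - q3 * y2) ^+ 2))%R; last by ring.
by rewrite Emp Er E1 E2 E3 E4; ring.
Qed.


(** Pigeonhole: squaring is at most two-to-one, so the squares and their images under [x -> -1 - x]
    each fill more than half of ['F_p], and the two sets meet. *)
Lemma prime_dvd_sum_sq (p : nat) : prime p -> odd p ->
  exists a b : 'F_p, (a ^+ 2 + b ^+ 2 + 1 = 0)%R.
Proof.
move=> p_pr p_odd.
pose sq := [set (x ^+ 2)%R | x : 'F_p].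
pose nsq := [set (- 1 - x)%R | x in sq].
have card_sq : #|'F_p| <= 2 * #|sq|.
  rewrite -[#|'F_p|]sum1_card
    (partition_big (fun x : 'F_p => x ^+ 2)%R (mem sq)) /=; last first.
    by move=> x _; apply: imset_f.
  apply: (@leq_trans (\sum_(y in sq) 2)); last by rewrite sum_nat_const mulnC.
  apply: leq_sum => _ /imsetP[b _ ->].
  rewrite sum1dep_card.
  rewrite (leq_trans (subset_leq_card (_ : _ \subset [set b; - b]%R))) //.
    by apply/subsetP => x; rewrite !inE eqf_sqr.
  by rewrite cards2; case: (_ != _).
have card_nsq : #|nsq| = #|sq|.
  by apply: card_imset => x y /addrI /oppr_inj.
have /set0Pn[z] : sq :&: nsq != set0.
  apply: contraTneq card_sq => sq0; rewrite -ltnNge card_Fp //.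
  have := cardsUI sq nsq; rewrite sq0 cards0 card_nsq addn0 => cU.
  have : #|sq :|: nsq| <= #|'F_p| := max_card _.
  rewrite card_Fp // cU addnn -mul2n leq_eqVlt => /predU1P[Ep|//].
  by have := congr1 odd Ep; rewrite oddM p_odd.
rewrite inE => /andP[/imsetP[a _ ->]] /imsetP[_ /imsetP[b _ ->]] Eab.
by exists a, b; rewrite Eab; ring.
Qed.

Lemma sum4sq_prime (p : nat) : prime p -> sum4sq p.
Proof.
move=> p_pr; have [->|p_odd] := even_prime p_pr; first by exists 1%R, 1%R, 0%R, 0%R.
have p_gt1 := prime_gt1 p_pr.
have p_gt2 : 2 < p by case: (p) p_gt1 p_odd => [|[|[|]]].
have start : exists2 m, 0 < m < p & sum4sq (m * p).
  have [a0 [b0 Eab]] := prime_dvd_sum_sq _ p_pr p_odd.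
  have p_gt0 : 0 < p by lia.
  have [a [q [Ea lea]]] := centered_residue p (a0 : nat)%:Z p_gt0.
  have [b [t [Eb leb]]] := centered_residue p (b0 : nat)%:Z p_gt0.
  have : p %| (a0 : nat) ^ 2 + (b0 : nat) ^ 2 + 1.
    rewrite (dvdn_pcharf (pchar_Fp p_pr)) !natrD !natrX !natr_Zp.
    by rewrite Eab.
  case/dvdnP => k Ek.
  have Ek' : ((a0 : nat)%:Z ^+ 2 + (b0 : nat)%:Z ^+ 2 + 1 = k%:Z * p%:Z)%R.
    by rewrite -PoszM -Ek !PoszD -!rmorphXn.
  (* [k] is the cofactor for the residues in [[0, p)], and [m] the one for the centered residues,
     whose size gives [m < p]. *)
  pose m := (k%:Z - (2 * a * q + p%:Z * q ^+ 2 + 2 * b * t + p%:Z * t ^+ 2))%R.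
  have Em : (m * p%:Z = a ^+ 2 + b ^+ 2 + 1)%R.
    by rewrite /m mulrBl -Ek' Ea Eb; ring.
  have m_gt0 : (0 < m)%R.
    rewrite -(pmulr_lgt0 m (_ : 0 < p%:Z)%R) ?ltz_nat // Em.
    by have := sqr_ge0 a; have := sqr_ge0 b; lra.
  have m_ltp : (m < p%:Z)%R.
    rewrite -(ltr_pM2r (_ : 0 < p%:Z)%R) ?ltz_nat // Em.
    have := ltn_mul p_gt2 p_gt2; rewrite -ltz_nat [Posz (p * p)]PoszM => p_sqr.
    by lra.
  exists `|m|%N; first by rewrite -!ltz_nat gtz0_abs // m_gt0.
  exists a, b, 1%R, 0%R; rewrite PoszM.
  by rewrite gtz0_abs // Em; ring.
case: start => m; elim/ltn_ind: m => m IHm /andP[m_gt0 m_ltp].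
case: (ltngtP m 1) m_gt0 => // [m_gt1|->] _; last by rewrite mul1n.
case/sum4sq_descent => //; first by rewrite m_gt1.
move=> r /andP[r_gt0 r_ltm]; apply: IHm => //.
by rewrite r_gt0 (ltn_trans r_ltm).
Qed.

Lemma lagrange_four_squares (n : nat) : sum4sq n.
Proof.
elim/ltn_ind: n => n IHn; have [n_gt1|n_le1] := ltnP 1 n; last first.
  case: n n_le1 {IHn} => [|[|//]] _; first by exists 0%R, 0%R, 0%R, 0%R.
  by exists 1%R, 0%R, 0%R, 0%R.
have p_pr := pdiv_prime n_gt1; have p_gt1 := prime_gt1 p_pr.
rewrite -(divnK (pdiv_dvd n)); apply: sum4sq_mul; last exact: sum4sq_prime.
by apply: IHn; rewrite ltn_Pdiv // ltnW.
Qed.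

(** * Partitions into squares as sorted lists *)

(** Forgetting the bound in ['I_n.+1] puts the partitions of different [n] in one type, so that a
    part can be inserted. *)
Definition square_parts (n j : nat) : seq (seq nat) :=
  [seq map val (val t) | t <- enum (square_partitions n j)].

Lemma size_square_parts n j : size (square_parts n j) = p2 n j.
Proof. by rewrite size_map -cardE. Qed.

Lemma uniq_square_parts n j : uniq (square_parts n j).
Proof.
rewrite map_inj_uniq ?enum_uniq // => s t /(inj_map val_inj).
exact: val_inj.
Qed.

Lemma sumn_map_val n j (t : j.-tuple 'I_n) :
  sumn (map val t) = \sum_(i < j) tnth t i.
Proof. by rewrite sumnE big_map big_tuple. Qed.

Lemma mem_square_parts n j s :
  (s \in square_parts n j) =
  [&& size s == j, sorted leq s, all is_pos_square s & sumn s == n].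
Proof.
apply/mapP/and4P => [[t] | [/eqP sz srt sq /eqP sm]].
  rewrite mem_enum inE => /and3P[srt sq /eqP sm] ->; split => //.
    by rewrite size_map size_tuple.
  by rewrite sumn_map_val sm.
have lt_s x : x \in s -> x < n.+1.
  by move=> xs; rewrite ltnS -sm sumnE (big_rem x xs) leq_addr.
have sz' : size (map (@inord n) s) == j by rewrite size_map sz.
have val_s : map val (map (@inord n) s) = s.
  rewrite -map_comp -[RHS]map_id; apply/eq_in_map => x /lt_s lt_x /=.
  by rewrite inordK.
exists (Tuple sz'); last by rewrite [val (Tuple _)]/= val_s.
rewrite mem_enum inE [tval _]/= val_s srt sq /=.
by rewrite -sumn_map_val /= val_s sm.
Qed.

Lemma is_pos_squareP m :
  reflect (exists2 k, 0 < k & m = k ^ 2) (is_pos_square m).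
Proof.
apply: (iffP existsP) => [[k /andP[k0 /eqP ->]] | [k k0 ->]]; first by exists k.
have lt_k : k < (k ^ 2).+1 by rewrite ltnS expnS expn1 leq_pmulr.
by exists (Ordinal lt_k); rewrite /= k0 eqxx.
Qed.

Lemma sort_mem_square_parts n j s :
  size s = j -> all is_pos_square s -> sumn s = n ->
  sort leq s \in square_parts n j.
Proof.
move=> sz sq sm; rewrite mem_square_parts size_sort sz eqxx all_sort sq.
rewrite (sort_sorted leq_total) /=.
by rewrite (perm_sumn (permEl (perm_sort leq s))) sm.
Qed.

Lemma insert_square_parts n j k s : 0 < k ->
  s \in square_parts n j -> sort leq (k ^ 2 :: s) \in square_parts (k ^ 2 + n) j.+1.
Proof.
rewrite mem_square_parts => k0 /and4P[/eqP sz _ sq /eqP sm].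
apply: sort_mem_square_parts; rewrite /= ?sz ?sm // sq andbT.
by apply/is_pos_squareP; exists k.
Qed.

Lemma leq_p2_insert n j k : 0 < k -> p2 n j <= p2 (k ^ 2 + n) j.+1.
Proof.
move=> k0; rewrite -!size_square_parts.
rewrite -(size_map (fun s => sort leq (k ^ 2 :: s))).
apply: uniq_leq_size => [|_ /mapP[s s_in ->]]; last exact: insert_square_parts.
rewrite map_inj_in_uniq ?uniq_square_parts // => s t.
rewrite !mem_square_parts => /and4P[_ srt_s _ _] /and4P[_ srt_t _ _] Est.
(* A sorted list is determined by its multiset, from which [k ^ 2] can be cancelled. *)
apply: (sorted_eq leq_trans anti_leq srt_s srt_t).
by move/(perm_sortP leq_total leq_trans anti_leq): Est; rewrite perm_cons.
Qed.

(** The [K] distinct squares all occur in the concatenation of all partitions of [n], a list of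
    length [j.+1 * p2 n j.+1]. *)
Lemma leq_card_p2_insert n j K :
  (forall k, 0 < k <= K -> exists2 m, n = k ^ 2 + m & 0 < p2 m j) ->
  K <= j.+1 * p2 n j.+1.
Proof.
move=> HK; have sz_flat : size (flatten (square_parts n j.+1)) = j.+1 * p2 n j.+1.
  rewrite size_flatten /shape sumnE big_map.
  rewrite (eq_big_seq (fun=> j.+1)) => [|s].
    by rewrite big_const_seq count_predT iter_addn_0 size_square_parts.
  by rewrite mem_square_parts => /and4P[/eqP].
rewrite -sz_flat -{1}(size_iota 1 K) -(size_map (fun k => k ^ 2)).
apply: uniq_leq_size => [|_ /mapP[k k_in ->]].
  by rewrite map_inj_uniq ?iota_uniq // => a b /eqP; rewrite eqn_exp2r // => /eqP.
rewrite mem_iota add1n ltnS in k_in; have [m -> p2_gt0] := HK k k_in.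
have /hasP[s s_in _] : has predT (square_parts m j).
  by rewrite has_predT size_square_parts.
have k0 : 0 < k by case/andP: k_in.
apply/flattenP; exists (sort leq (k ^ 2 :: s)).
  exact: insert_square_parts.
by rewrite mem_sort mem_head.
Qed.

(** * Enumerating and tabulating the partitions *)

(** Roots are at most [m]. Either [m ^ 2] is not a part and [m] drops, or one copy is removed as
    last part and [j] drops while [m] stays; this lexicographic recursion explains the nested
    [fix]. *)
Fixpoint parts_upto (j m : nat) : nat -> seq (seq nat) :=
  if j is j'.+1 then
    (fix go m n := if m is m'.+1 then
       go m' n ++ (if m ^ 2 <= n
                   then [seq rcons s (m ^ 2) | s <- parts_upto j' m (n - m ^ 2)]
                   else [::])
     else [::]) m
  else fun n => if n is 0 then [:: [::]] else [::].

Lemma parts_uptoS j m n : parts_upto j.+1 m.+1 n =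
  parts_upto j.+1 m n ++
  if m.+1 ^ 2 <= n then
    [seq rcons s (m.+1 ^ 2) | s <- parts_upto j m.+1 (n - m.+1 ^ 2)]
  else [::].
Proof. by []. Qed.

Lemma rcons_square_parts n j s x :
  (rcons s x \in square_parts n j.+1) =
  [&& is_pos_square x, x <= n, all (geq x) s & s \in square_parts (n - x) j].
Proof.
rewrite !mem_square_parts size_rcons eqSS all_rcons sumn_rcons.
rewrite !(sorted_pairwise leq_trans) pairwise_rcons.
have -> : (sumn s + x == n) = (x <= n) && (sumn s == n - x) by lia.
rewrite (eq_all (_ : leq^~ x =1 geq x)) //.
by case: (is_pos_square x) (x <= n) (all (geq x) s) => [] [] [];
  rewrite /= ?andbF ?andbT.
Qed.

Lemma mem_parts_upto j m n s :
  (s \in parts_upto j m n) =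
  (s \in square_parts n j) && all (geq (m ^ 2)) s.
Proof.
elim: j m n s => [|j IHj] m n s.
  by rewrite mem_square_parts; case: n s => [|n] [|x s]; rewrite /= ?inE ?andbF.
elim: m s => [|m IHm] s.
  rewrite mem_square_parts; case: s => [|x s] //=; rewrite in_nil; apply/esym/negP.
  by move=> /andP[/and4P[_ _ /andP[/is_pos_squareP[k k0 ->] _] _]] /andP[/=]; lia.
rewrite parts_uptoS mem_cat IHm; apply/orP/andP.
  case=> [/andP[-> /allP le_s]|].
    split=> //; apply/allP => x /le_s /= le_x.
    by rewrite (leq_trans le_x) ?leq_exp2r.
  case: ifP => // le_mn /mapP[t]; rewrite IHj => /andP[t_in le_t] ->.
  rewrite rcons_square_parts all_rcons le_mn le_t t_in /= leqnn andbT; split=> //.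
  by apply/is_pos_squareP; exists m.+1.
case/lastP: s => [|s x]; first by rewrite mem_square_parts => -[].
rewrite rcons_square_parts all_rcons.
move=> -[/and4P[sq_x le_xn le_s s_in]] /andP[/= le_x _].
case/is_pos_squareP: (sq_x) => k k0 Ex.
move: le_x; rewrite Ex leq_exp2r // leq_eqVlt => /predU1P[Ek|lt_km].
  right; rewrite -Ek -Ex le_xn; apply/mapP; exists s => //.
  by rewrite IHj -Ex s_in.
left; rewrite -Ex ?rcons_square_parts ?all_rcons sq_x le_xn le_s s_in /=.
have le_xm : x <= m ^ 2 by rewrite Ex leq_exp2r.
by rewrite le_xm; apply: sub_all le_s => y /= le_y; apply: leq_trans le_xm.
Qed.

Lemma uniq_parts_upto j m n : uniq (parts_upto j m n).
Proof.
elim: j m n => [|j IHj] m n; first by case: n.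
elim: m => // m IHm; rewrite parts_uptoS cat_uniq IHm /=.
case: ifP => // le_mn; rewrite map_inj_uniq ?IHj ?andbT; last exact: rcons_injl.
apply/hasPn => _ /mapP[s _ ->]; apply/negP => s_in.
have : rcons s (m.+1 ^ 2) \in parts_upto j.+1 m n := s_in.
by rewrite mem_parts_upto all_rcons /= leq_exp2r // ltnn andbF.
Qed.

Lemma size_parts_upto j m n : n < m.+1 ^ 2 -> size (parts_upto j m n) = p2 n j.
Proof.
move=> lt_nm; rewrite -size_square_parts; apply/perm_size/uniq_perm.
- exact: uniq_parts_upto.
- exact: uniq_square_parts.
move=> s; rewrite mem_parts_upto; apply: andb_idr.
rewrite mem_square_parts => /and4P[_ _ /allP sq /eqP sm].
apply/allP => x x_in /=; have /is_pos_squareP[k k0 Ex] := sq _ x_in.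
have le_xn : x <= n by rewrite -sm sumnE (big_rem x x_in) leq_addr.
have : k ^ 2 < m.+1 ^ 2 by rewrite -Ex; apply: leq_ltn_trans lt_nm.
by rewrite Ex ltn_exp2r // leq_exp2r.
Qed.

(** The result keeps the length of [s]: in use, [t] is a shifted row whose overhang past [N] is cut
    off. *)
Fixpoint add_seq (s t : seq nat) : seq nat :=
  match s, t with
  | a :: s', b :: t' => (a + b) :: add_seq s' t'
  | _, _ => s
  end.

Lemma size_add_seq s t : size (add_seq s t) = size s.
Proof. by elim: s t => [|a s IHs] [|b t] //=; rewrite IHs. Qed.

Lemma nth_add_seq s t i : i < size s -> size s <= size t ->
  nth 0 (add_seq s t) i = nth 0 s i + nth 0 t i.
Proof.
by elim: s t i => [|a s IHs] [|b t] [|i] //=; rewrite !ltnS; apply: IHs.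
Qed.

(** Admits the square [k] as a part: each row gains the preceding row shifted by [k]. That row is
    already updated, so [k] may be repeated. *)
Fixpoint next_rows (k : nat) (prev : seq nat) (rows : seq (seq nat)) :=
  if rows is row :: rows' then
    let row' := add_seq row (nseq k 0 ++ prev) in row' :: next_rows k row' rows'
  else [::].

(* Row j, entry n of the table is the number of partitions of n into j squares
   of roots at most m, for j <= J and n <= N. *)
Fixpoint count_table (N J m : nat) : seq (seq nat) :=
  if m is m'.+1 then
    if count_table N J m' is row0 :: rows then
      row0 :: next_rows (m ^ 2) row0 rows
    else [::]
  else (1 :: nseq N 0) :: nseq J (nseq N.+1 0).

Definition count_row (N m j : nat) : seq nat :=
  mkseq (fun n => size (parts_upto j m n)) N.+1.

Lemma add_count_row N m j :
  add_seq (count_row N m j.+1) (nseq (m.+1 ^ 2) 0 ++ count_row N m.+1 j) =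
  count_row N m.+1 j.+1.
Proof.
apply: (@eq_from_nth _ 0) => [|n]; first by rewrite size_add_seq !size_mkseq.
rewrite size_add_seq size_mkseq => lt_nN.
rewrite nth_add_seq ?size_cat ?(size_mkseq, leq_addl) //.
have lt_n'N : n - m.+1 ^ 2 < N.+1 by apply: leq_ltn_trans (leq_subr _ _) lt_nN.
rewrite nth_cat size_nseq nth_nseq !nth_mkseq // parts_uptoS size_cat.
by congr (_ + _); case: leqP => // _; rewrite size_map.
Qed.

Lemma next_count_rows N m j l :
  next_rows (m.+1 ^ 2) (count_row N m.+1 j)
    [seq count_row N m i | i <- iota j.+1 l] =
  [seq count_row N m.+1 i | i <- iota j.+1 l].
Proof.
elim: l j => // l IHl j; rewrite [iota _ _]/= !map_cons.
by rewrite -(IHl j.+1) -[in RHS](add_count_row N m j).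
Qed.

Lemma count_tableE N J m :
  count_table N J m = [seq count_row N m j | j <- iota 0 J.+1].
Proof.
elim: m => [|m IHm].
  rewrite [iota _ _]/= map_cons; congr (_ :: _).
    apply: (@eq_from_nth _ 0) => [|[|n] //].
      by rewrite size_mkseq /= size_nseq.
    rewrite [size _]/= size_nseq => lt_nN.
    by rewrite nth_mkseq // [LHS]/= nth_nseq if_same.
  apply: (@eq_from_nth _ [::]) => [|j].
    by rewrite size_nseq size_map size_iota.
  rewrite size_nseq => lt_jJ; rewrite nth_nseq lt_jJ (nth_map 0) ?size_iota //.
  rewrite nth_iota //; apply: (@eq_from_nth _ 0) => [|n].
    by rewrite size_mkseq size_nseq.
  by rewrite size_nseq => lt_nN; rewrite nth_mkseq // nth_nseq if_same.
rewrite -[LHS]/(if count_table N J m is row0 :: rows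
  then row0 :: next_rows (m.+1 ^ 2) row0 rows else [::]) IHm.
by rewrite [iota _ _]/= !map_cons -next_count_rows.
Qed.

Lemma nth_count_table N J m j n : j <= J -> n <= N -> n < m.+1 ^ 2 ->
  nth 0 (nth [::] (count_table N J m) j) n = p2 n j.
Proof.
move=> le_jJ le_nN lt_nm; rewrite count_tableE (nth_map 0) ?size_iota //.
by rewrite nth_iota // nth_mkseq // size_parts_upto.
Qed.

(** * The finite check, five positive squares, and the ranges of n *)

Lemma p2_small_values :
  (forall n, n <= 700 -> p2 n 6 != 36) /\
  (forall n, 700 <= n <= 1130 -> 36 < p2 n 5).
Proof.
(* The table extends past [1130], and roots up to [34] suffice there since 35^2 = 1225. *)
pose t := count_table 1155 6 34.
have : all (fun n => nth 0 (nth [::] t 6) n != 36) (iota 0 701) &&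
       all (fun n => 36 < nth 0 (nth [::] t 5) n) (iota 700 431).
  by vm_compute.
case/andP=> /allP small6 /allP small5; split=> n n_bound.
  have := small6 n; rewrite mem_iota nth_count_table //; first by apply.
  - by apply: leq_trans n_bound _.
  - by apply: leq_ltn_trans n_bound _.
case/andP: n_bound => n_ge n_le.
have := small5 n; rewrite mem_iota nth_count_table //; first by apply; rewrite n_ge.
- by apply: leq_trans n_le _.
- by apply: leq_ltn_trans n_le _.
Qed.

Lemma five_pos_squares n : 169 <= n -> 0 < p2 n 5.
Proof.
move=> n_ge.
have [r r_gt0 [sz sm]] : exists2 r, all (leq 1) r &
    size r = 5 /\ sumn [seq x ^ 2 | x <- r] = n.
  have [a [b [c [d Eabcd]]]] := lagrange_four_squares (n - 169).
  have {Eabcd} E : n - 169 = `|a| ^ 2 + `|b| ^ 2 + `|c| ^ 2 + `|d| ^ 2.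
    apply/eqP; rewrite -eqz_nat Eabcd !PoszD -!abszX.
    by rewrite !gez0_abs ?sqr_ge0.
  pose q := [:: `|a|; `|b|; `|c|; `|d|]%N; pose s := filter (leq 1) q.
  have sm_s : sumn [seq x ^ 2 | x <- s] + 169 = n.
    have -> : sumn [seq x ^ 2 | x <- s] = sumn [seq x ^ 2 | x <- q].
      by rewrite /s; elim: (q) => //= -[|x] q' IHq /=; rewrite IHq.
    by rewrite /q /= addn0 !addnA -E subnK.
  (* Entry [i] holds [5 - i] positive roots with squares summing to 169; as [size s <= 4], the
     default is never reached. *)
  pose pad := nth [::] [:: [:: 5; 6; 6; 6; 6]; [:: 2; 4; 7; 10];
                           [:: 3; 4; 12]; [:: 5; 12]; [:: 13]] (size s).
  have sz_s : size s <= 4 by rewrite size_filter count_size.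
  have [pad_gt0 sz_pad sm_pad] : [/\ all (leq 1) pad, size pad = 5 - size s &
      sumn [seq x ^ 2 | x <- pad] = 169].
    by rewrite /pad; move: (size s) sz_s => [|[|[|[|[|]]]]].
  exists (s ++ pad); first by rewrite all_cat filter_all.
  rewrite size_cat sz_pad subnKC ?(leq_trans sz_s) //.
  by rewrite map_cat sumn_cat sm_pad.
rewrite -size_square_parts -has_predT; apply/hasP.
exists (sort leq [seq x ^ 2 | x <- r]) => //.
apply: sort_mem_square_parts; rewrite ?size_map // all_map.
by apply: sub_all r_gt0 => x x_gt0; apply/is_pos_squareP; exists x.
Qed.

Lemma floor_sqrt n : exists k, k ^ 2 <= n < k.+1 ^ 2.
Proof.
elim: n => [|n [k /andP[le_kn lt_nk]]]; first by exists 0.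
have [lt_Snk|le_kSn] := ltnP n.+1 (k.+1 ^ 2).
  by exists k; rewrite lt_Snk (leq_trans le_kn).
by exists k.+1; rewrite le_kSn (leq_ltn_trans lt_nk) // ltn_exp2r.
Qed.

Theorem theorem6p4 : ~ exists n : nat, 0 < n /\ p2 n 6 = 36.
Proof.
case=> n [_ En]; have [small6 small5] := p2_small_values.
have [/small6|n_gt700] := leqP n 700; first by rewrite En.
have [n_ge|n_lt] := leqP (217 ^ 2 + 169) n.
  suff : 217 <= 6 * p2 n 6 by rewrite En.
  apply: leq_card_p2_insert => k /andP[_ le_k].
  have le_k2 : k ^ 2 <= 217 ^ 2 by rewrite leq_exp2r.
  have le_kn : k ^ 2 + 169 <= n by apply: leq_trans n_ge; rewrite leq_add2r.
  exists (n - k ^ 2); first by rewrite subnKC // (leq_trans _ le_kn) ?leq_addr.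
  by apply: five_pos_squares; rewrite leq_subRL // (leq_trans _ le_kn) ?leq_addr.
(* This choice of [k] puts [n - k ^ 2] between [700] and [700 + 2 * k]. *)
have [k /andP[le_k lt_k]] := floor_sqrt (n - 700).
have k_gt0 : 0 < k.
  by case: k {le_k} lt_k => //; rewrite exp1n ltnS leqn0 subn_eq0 leqNgt n_gt700.
(* Here [n - 700 < 47258 - 700 < 216 ^ 2]; then [k <= 215] gives exactly the upper end
   [1130 = 700 + 2 * 215] of the window. *)
have k_lt : k < 216.
  rewrite -(@ltn_exp2r _ _ 2) //; apply: leq_ltn_trans le_k _.
  by move: n_lt; lia.
have Ek : k.+1 ^ 2 = k ^ 2 + k.*2.+1 by rewrite -addn1 sqrnD; lia.
have r_bounds : 700 <= n - k ^ 2 <= 1130.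
  by move: le_k lt_k; rewrite Ek; move: (k ^ 2) => k2; lia.
have := leq_trans (small5 _ r_bounds) (leq_p2_insert (n - k ^ 2) 5 k k_gt0).
by rewrite subnKC ?En //; move: le_k; move: (k ^ 2) => k2; lia.
Qed.
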